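(* Let $A,B$ be positive integers such that $A$ is prime to $p$ and $A$, $B$ and $A+B$ are all FM-exponents for $p$. Then $(A,B)$ or $(B,A)$ is one of the following pairs: (1) $\big(\frac{p^a+1}{p^b+1},\,p^b\frac{p^a+1}{p^b+1}\big)$ with $b\ge1$ and $a\ge b$ an odd multiple of $b$; (2) $\big(\frac{p^{a+2b}+1}{p^b+1},\,p^b\frac{p^a+1}{p^b+1}\big)$ with $b\ge1$ and $a\ge b$ an odd multiple of $b$; (3) $p\ge3$: $\big(\frac{p^a+1}{2},\frac{p^a+1}{2}\big)$, $a\ge0$; (4) $p=2$: $(3,10),(5,6),(5,8),(5,17),(5,52),(9,2),(9,4),(9,11),(9,13),(9,17),(9,34),(9,43),(9,48),(11,2),(11,13),(11,57),(13,44),(13,228),(17,26),(17,40),(33,10),(33,24),(33,172),(33,208),(65,176),(171,34),(205,36)$; (5) $p=2$: $(2^a+1,2^a+1)$, $a\ge1$; (6) $p=2$: $\big(\frac{2^a+1}{2^b+1},\frac{2^a+1}{2^b+1}\big)$, $b\ge1$, $a$ an odd multiple of $b$; (7) $p=2$: $(1,2^a+1)$, $a\ge1$; (8) $p=2$: $(2^a+1,2^a)$, $a\ge1$; (9) $p=2$: $(3,2^a+1)$, $a\ge1$; (10) $p=2$: $(2^a+1,3\cdot2^a)$, $a\ge1$; (11) $p=2$: $\big(2^a+1,\frac{2^{3a}+1}{2^a+1}\big)$, $a\ge1$; (12) $p=2$: $\big(\frac{2^{3a}+1}{2^a+1},2^a(2^a+1)\big)$, $a\ge1$; (13) $p=2$: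 $\big(2^a+1,\frac{2^a+1}{3}\big)$, $a\ge1$ odd; (14) $p=2$: $\big(1,\frac{2^a+1}{3}\big)$, $a\ge1$ odd; (15) $p=2$: $\big(\frac{2^a+1}{3},2^a\big)$, $a\ge1$ odd; (16) $p=2$: $\big(3,\frac{2^{2a}+1}{5}\big)$, $a\ge1$ odd; (17) $p=2$: $\big(\frac{2^{2a}+1}{5},3\cdot2^{2a}\big)$, $a\ge1$ odd; (18) $p=2$: $\big(5,\frac{2^a+1}{3}\big)$, $a\ge1$ odd; (19) $p=2$: $\big(\frac{2^a+1}{3},5\cdot2^a\big)$, $a\ge1$ odd; (20) $p=2$: $\big(\frac{2^{3a}+1}{9},\frac{2^{3a}+1}{3}\big)$, $a\ge1$ odd; (21) $p=2$: $\big(\frac{2^{3a}+1}{9},2\cdot\frac{2^{3a}+1}{9}\big)$, $a\ge1$ odd; (22) $p=3$: $(2,5),(4,3),(4,10),(5,7),(10,63),(28,45),(61,12)$; (23) $p=3$: $(2,3^a+1)$, $a\ge0$; (24) $p=3$: $(3^a+1,2\cdot3^a)$, $a\ge0$; (25) $p=3$: $\big(3^a+1,\frac{3^a+1}{2}\big)$, $a\ge0$; (26) $p=3$: $\big(1,\frac{3^a+1}{2}\big)$, $a\ge0$; (27) $p=3$: $\big(\frac{3^a+1}{2},3^a\big)$, $a\ge0$; (28) $p=3$: $\big(4,\frac{3^a+1}{2}\big)$, $a\ge0$; (29) $p=3$: $\big(\frac{3^a+1}{2},4\cdot3^a\big)$, $a\ge0$; (30) $p=3$: $\big(\frac{3^a+1}{2},\frac{3^a+1}{4}\big)$,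 $a\ge1$ odd; (31) $p=3$: $\big(\frac{3^a+1}{4},\frac{3^a+1}{4}\big)$, $a\ge1$ odd; (32) $p=3$: $\big(2,\frac{3^a+1}{4}\big)$, $a\ge1$ odd; (33) $p=3$: $\big(\frac{3^a+1}{4},2\cdot3^a\big)$, $a\ge1$ odd; (34) $p=5$: $(1,6),(2,5),(3,7),(6,7),(6,15)$; (35) $p=5$: $\big(2,\frac{5^a+1}{2}\big)$, $a\ge0$; (36) $p=5$: $\big(\frac{5^a+1}{2},2\cdot5^a\big)$, $a\ge0$; (37) $p=7$: $(2,2)$.
   Context: $p$ is a prime. For a positive integer $n$, $n_{\hat p}$ is its prime-to-$p$ part. A positive integer $d$ is an FM-exponent for $p$ if $d_{\hat p}$ is of one of the forms: (i) $p^a+1$ with $a\ge0$ ($a>0$ if $p=2$); (ii) $p>2$ and $\frac{p^a+1}{2}$ with $a>0$; (iii) $\frac{p^{ab}+1}{p^a+1}$ with $a,b>0$ and $b$ odd (including $1$); (iv) $p=5$ and $d_{\hat p}=7$. *)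

(* Defs.v *)
From mathcomp Require Import all_boot.
Set Implicit Arguments. Unset Strict Implicit. Unset Printing Implicit Defensive.

Definition ppart_hat (p n : nat) : nat := n`_(p^').

Definition FM_exponent (p d : nat) : Prop :=
  0 < d /\
  let m := ppart_hat p d in
  [\/ exists a, m = p ^ a + 1 /\ (p = 2 -> 0 < a),
      2 < p /\ exists a, 0 < a /\ m = (p ^ a + 1) %/ 2,
      exists a b, [/\ 0 < a, 0 < b, odd b & m = (p ^ (a * b) + 1) %/ (p ^ a + 1)]
    | p = 5 /\ m = 7].

Definition odd_mult (a b : nat) : Prop := b <= a /\ b %| a /\ odd (a %/ b).

Definition sporadic2 : seq (nat * nat) :=
  [:: (3,10); (5,6); (5,8); (5,17); (5,52); (9,2); (9,4); (9,11); (9,13);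
      (9,17); (9,34); (9,43); (9,48); (11,2); (11,13); (11,57); (13,44);
      (13,228); (17,26); (17,40); (33,10); (33,24); (33,172); (33,208);
      (65,176); (171,34); (205,36)].

Definition sporadic3 : seq (nat * nat) :=
  [:: (2,5); (4,3); (4,10); (5,7); (10,63); (28,45); (61,12)].

Definition sporadic5 : seq (nat * nat) :=
  [:: (1,6); (2,5); (3,7); (6,7); (6,15)].

(* The list (1)-(37) of the theorem; all divisions below are exact under the
   stated side conditions. *)
Definition FM_pair (p x y : nat) : Prop :=
  (* (1) *)
  (exists a b, [/\ 1 <= b, odd_mult a b &
     (x, y) = ((p ^ a + 1) %/ (p ^ b + 1), p ^ b * ((p ^ a + 1) %/ (p ^ b + 1)))]) \/
  (* (2) *)
  (exists a b, [/\ 1 <= b, odd_mult a b &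
     (x, y) = ((p ^ (a + 2 * b) + 1) %/ (p ^ b + 1), p ^ b * ((p ^ a + 1) %/ (p ^ b + 1)))]) \/
  (* (3) *)
  (3 <= p /\ exists a, (x, y) = ((p ^ a + 1) %/ 2, (p ^ a + 1) %/ 2)) \/
  (p = 2 /\ (
      (* (4) *) ((x, y) \in sporadic2) \/
      (* (5) *) (exists a, 1 <= a /\ (x, y) = (2 ^ a + 1, 2 ^ a + 1)) \/
      (* (6) *) (exists a b, [/\ 1 <= b, odd_mult a b & (x, y) = ((2 ^ a + 1) %/ (2 ^ b + 1), (2 ^ a + 1) %/ (2 ^ b + 1))]) \/
      (* (7) *) (exists a, 1 <= a /\ (x, y) = (1, 2 ^ a + 1)) \/
      (* (8) *) (exists a, 1 <= a /\ (x, y) = (2 ^ a + 1, 2 ^ a)) \/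
      (* (9) *) (exists a, 1 <= a /\ (x, y) = (3, 2 ^ a + 1)) \/
      (* (10) *) (exists a, 1 <= a /\ (x, y) = (2 ^ a + 1, 3 * 2 ^ a)) \/
      (* (11) *) (exists a, 1 <= a /\ (x, y) = (2 ^ a + 1, (2 ^ (3 * a) + 1) %/ (2 ^ a + 1))) \/
      (* (12) *) (exists a, 1 <= a /\ (x, y) = ((2 ^ (3 * a) + 1) %/ (2 ^ a + 1), 2 ^ a * (2 ^ a + 1))) \/
      (* (13) *) (exists a, [/\ 1 <= a, odd a & (x, y) = (2 ^ a + 1, (2 ^ a + 1) %/ 3)]) \/
      (* (14) *) (exists a, [/\ 1 <= a, odd a & (x, y) = (1, (2 ^ a + 1) %/ 3)]) \/
      (* (15) *) (exists a, [/\ 1 <= a, odd a & (x, y) = ((2 ^ a + 1) %/ 3, 2 ^ a)]) \/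
      (* (16) *) (exists a, [/\ 1 <= a, odd a & (x, y) = (3, (2 ^ (2 * a) + 1) %/ 5)]) \/
      (* (17) *) (exists a, [/\ 1 <= a, odd a & (x, y) = ((2 ^ (2 * a) + 1) %/ 5, 3 * 2 ^ (2 * a))]) \/
      (* (18) *) (exists a, [/\ 1 <= a, odd a & (x, y) = (5, (2 ^ a + 1) %/ 3)]) \/
      (* (19) *) (exists a, [/\ 1 <= a, odd a & (x, y) = ((2 ^ a + 1) %/ 3, 5 * 2 ^ a)]) \/
      (* (20) *) (exists a, [/\ 1 <= a, odd a & (x, y) = ((2 ^ (3 * a) + 1) %/ 9, (2 ^ (3 * a) + 1) %/ 3)]) \/
      (* (21) *) (exists a, [/\ 1 <= a, odd a & (x, y) = ((2 ^ (3 * a) + 1) %/ 9, 2 * ((2 ^ (3 * a) + 1) %/ 9))]))) \/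
  (p = 3 /\ (
      (* (22) *) ((x, y) \in sporadic3) \/
      (* (23) *) (exists a, (x, y) = (2, 3 ^ a + 1)) \/
      (* (24) *) (exists a, (x, y) = (3 ^ a + 1, 2 * 3 ^ a)) \/
      (* (25) *) (exists a, (x, y) = (3 ^ a + 1, (3 ^ a + 1) %/ 2)) \/
      (* (26) *) (exists a, (x, y) = (1, (3 ^ a + 1) %/ 2)) \/
      (* (27) *) (exists a, (x, y) = ((3 ^ a + 1) %/ 2, 3 ^ a)) \/
      (* (28) *) (exists a, (x, y) = (4, (3 ^ a + 1) %/ 2)) \/
      (* (29) *) (exists a, (x, y) = ((3 ^ a + 1) %/ 2, 4 * 3 ^ a)) \/
      (* (30) *) (exists a, [/\ 1 <= a, odd a & (x, y) = ((3 ^ a + 1) %/ 2, (3 ^ a + 1) %/ 4)]) \/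
      (* (31) *) (exists a, [/\ 1 <= a, odd a & (x, y) = ((3 ^ a + 1) %/ 4, (3 ^ a + 1) %/ 4)]) \/
      (* (32) *) (exists a, [/\ 1 <= a, odd a & (x, y) = (2, (3 ^ a + 1) %/ 4)]) \/
      (* (33) *) (exists a, [/\ 1 <= a, odd a & (x, y) = ((3 ^ a + 1) %/ 4, 2 * 3 ^ a)]))) \/
  (p = 5 /\ (
      (* (34) *) ((x, y) \in sporadic5) \/
      (* (35) *) (exists a, (x, y) = (2, (5 ^ a + 1) %/ 2)) \/
      (* (36) *) (exists a, (x, y) = ((5 ^ a + 1) %/ 2, 2 * 5 ^ a)))) \/
  (* (37) *) (p = 7 /\ (x, y) = (2, 2)).

(* Main.v *)
Require Import Defs.
From mathcomp Require Import all_boot.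
From mathcomp Require Import all_algebra zify ring.

(** Every prime-to-[p] FM-exponent is [n / d] with [n = p^m + 1] and [d] one of
    [1], [2], [p^a + 1] (or it is [1] or [7]).  Since [A] is prime to [p], at most
    one of [B] and [A + B] is divisible by [p], so the hypothesis reads
    [x + p^k y = p^l z] with [k = 0] or [l = 0]; clearing denominators turns it
    into the vanishing of a sum of at most 24 terms [c * p^L], where [L] is a linear
    form with natural coefficients in at most seven natural parameters.

    In such a sum the smallest exponent cannot be attained only once by a
    coefficient prime to [p].  Comparing exponents by case distinctions
    [v_i <= v_j] and [v_i > v_j], where the substitutions [v_j := v_i + v_j] and
    [v_i := v_j + 1 + v_i] keep the parameters natural, one is therefore led in
    finitely many steps either to a contradiction or to an identically vanishing
    sum, that is to a parametrised family of solutions, which is compared with the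
    list.  For [p >= 11] no coefficient exceeds 10 in absolute value, so the same
    case distinction serves all these primes at once. *)

Set Implicit Arguments.
Unset Strict Implicit.
Unset Printing Implicit Defensive.

Import GRing.Theory.

(** * Linear forms in natural parameters *)

(* Variable 0 always has value 1, so entry 0 of a form is its constant term. *)
Definition form := seq nat.

Definition nvar := 8.

Definition eval (e : nat -> nat) (f : form) : nat :=
  \sum_(k < nvar) nth 0 f k * e k.

Definition addf (f g : form) : form :=
  mkseq (fun k => nth 0 f k + nth 0 g k) nvar.

Definition varf (i : nat) : form := mkseq (fun k => (k == i) : nat) nvar.

Definition cstf (c : nat) : form := mkseq (fun k => if k == 0 then c else 0) nvar.

(* The substitution [v_j := v_i + v_j], written on the coefficients of a form. *)
Definition shear (i j : nat) (f : form) : form :=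
  mkseq (fun k => if k == i then nth 0 f i + nth 0 f j else nth 0 f k) nvar.

Definition clear (j : nat) (f : form) : form :=
  mkseq (fun k => if k == j then 0 else nth 0 f k) nvar.

(** As the parameters range over the naturals and variable 0 is 1, this coefficientwise test is
    strict inequality at every point. *)
Definition ltf (f g : form) : bool :=
  (nth 0 f 0 < nth 0 g 0) && all (fun k => nth 0 f k <= nth 0 g k) (iota 0 nvar).

Definition upd (e : nat -> nat) (j v : nat) : nat -> nat :=
  fun k => if k == j then v else e k.

Lemma evalD1 e f j : j < nvar ->
  eval e f = nth 0 f j * e j + \sum_(k < nvar | (k : nat) != j) nth 0 f k * e k.
Proof. by move=> lt_j; rewrite /eval (bigD1 (Ordinal lt_j)). Qed.

Lemma eval_addf e f g : eval e (addf f g) = eval e f + eval e g.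
Proof.
rewrite /eval -big_split; apply: eq_bigr => k _.
by rewrite nth_mkseq // mulnDl.
Qed.

Lemma eval_varf e i : i < nvar -> eval e (varf i) = e i.
Proof.
move=> lt_i; rewrite (evalD1 _ _ lt_i) nth_mkseq // eqxx mul1n.
by rewrite big1 ?addn0 // => k /negPf ki; rewrite nth_mkseq // ki.
Qed.

Lemma eval_cstf e c : e 0 = 1 -> eval e (cstf c) = c.
Proof.
move=> e0; rewrite (@evalD1 _ _ 0) // nth_mkseq // eqxx e0 muln1.
by rewrite big1 ?addn0 // => k /negPf ki; rewrite nth_mkseq // ki.
Qed.

Lemma eval_shear e f i j : i < nvar -> j < nvar -> i != j -> e i <= e j ->
  eval (upd e j (e j - e i)) (shear i j f) = eval e f.
Proof.
(* Lowering [e j] by [e i] loses [nth 0 f j * e i]; the enlarged coefficient at [i] gives it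
   back. *)
move=> lt_i lt_j ij le_ij; transitivity (eval e (shear i j f) - nth 0 f j * e i).
  rewrite !(evalD1 _ _ lt_j) nth_mkseq // eq_sym (negPf ij) /upd eqxx mulnBr.
  rewrite addnBAC ?leq_mul2l ?le_ij ?orbT //; congr (_ + _ - _).
  by apply: eq_bigr => k /negPf ->.
rewrite !(evalD1 _ _ lt_i) nth_mkseq // eqxx mulnDl addnAC addnK.
by congr (_ + _); apply: eq_bigr => k /negPf ki; rewrite nth_mkseq // ki.
Qed.

Lemma eval_clear e f j : j < nvar -> e j = 0 -> eval e (clear j f) = eval e f.
Proof.
move=> lt_j ej; rewrite /eval; apply: eq_bigr => k _; rewrite nth_mkseq //.
by case: eqP => // ->; rewrite ej !muln0.
Qed.

Lemma eval_ltf e f g : e 0 = 1 -> ltf f g -> eval e f < eval e g.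
Proof.
move=> e0 /andP[lt0 /allP le_fg]; rewrite !(@evalD1 _ _ 0) // e0 !muln1.
rewrite -addSn leq_add // leq_sum // => k _; rewrite leq_mul2r le_fg ?orbT // mem_iota.
exact: ltn_ord k.
Qed.

(** * Sums of multiples of powers of [p] and their normal form *)

Definition terms := seq (int * form).

Local Notation tsum p e ts :=
  (\sum_(t <- (ts : terms)) t.1 * (p ^ eval e t.2)%:Z)%R.

(* [Some q] stands for the prime q, [None] for all primes at least 11; in the
   latter case the search only meets coefficients of absolute value at most 10. *)
Definition base := option nat.

Definition based (b : base) (p : nat) : Prop :=
  if b is Some q then p = q else 11 <= p.

Definition unitc (b : base) (c : int) : bool :=
  if b is Some q then ~~ (q%:Z %| c)%Z else 0 < `|c| < 11.

Definition lower (b : base) (c : int) : option int :=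
  if b is Some q then if (q%:Z %| c)%Z then Some (c %/ q%:Z)%Z else None else None.

Fixpoint pull (f : form) (ts : terms) : int * terms :=
  if ts is (c, g) :: ts' then
    if f == g then (c, ts') else let: (d, r) := pull f ts' in (d, (c, g) :: r)
  else (0%R, [::]).

(** A coefficient divisible by [q] moves to the next exponent, like a carry, and merges with an
    equal form there. When the fuel [n] is spent the term is kept as it is, so the sum is
    preserved. *)
Fixpoint insert (b : base) (n : nat) (c : int) (f : form) (ts : terms) : terms :=
  if n is n'.+1 then
    if c == 0%R then ts else
    if lower b c is Some c' then insert b n' c' (addf f (cstf 1)) ts else
    let: (d, r) := pull f ts in
    if d == 0%R then (c, f) :: ts else insert b n' (c + d)%R f r
  else (c, f) :: ts.

Definition normalize (b : base) (ts : terms) : terms :=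
  foldr (fun t => insert b 20 t.1 t.2) [::] ts.

Lemma pull_sum p e f ts :
  tsum p e ts = ((pull f ts).1 * (p ^ eval e f)%:Z + tsum p e (pull f ts).2)%R.
Proof.
elim: ts => [|[c g] ts IH] /=; first by rewrite big_nil mul0r addr0.
case: eqP => [<-|_]; rewrite big_cons //= IH.
by case: (pull f ts) => d r /=; rewrite big_cons /= addrCA.
Qed.

Lemma unitcP b p c : based b p -> unitc b c -> ~~ (p%:Z %| c)%Z.
Proof.
case: b => [q|] /= => [-> //|p11 /andP[c0 c11]].
by rewrite /dvdz /=; apply/negP => /(dvdn_leq c0); lia.
Qed.

Lemma insert_sum b p e n c f ts : based b p -> e 0 = 1 ->
  tsum p e (insert b n c f ts) = (c * (p ^ eval e f)%:Z + tsum p e ts)%R.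
Proof.
move=> bp e0; elim: n c f ts => [|n IH] c f ts /=; first by rewrite big_cons.
case: eqP => [->|_]; first by rewrite mul0r add0r.
case E: (lower b c) => [c'|].
  case: b bp E {IH} (IH c' (addf f (cstf 1)) ts) => [q|] //= ->.
  case: ifP => // q_c [<-] ->.
  rewrite eval_addf (eval_cstf _ e0) addn1 expnS PoszM mulrA divzK //.
have Ets := pull_sum p e f ts; case: (pull f ts) Ets => d r /= Ets.
by case: eqP => _; rewrite ?big_cons // IH Ets mulrDl addrA.
Qed.

Arguments insert : simpl never.

Lemma normalize_sum b p e ts : based b p -> e 0 = 1 ->
  tsum p e (normalize b ts) = tsum p e ts.
Proof.
move=> bp e0; elim: ts => [|[c f] ts IH] //=.
by rewrite insert_sum // IH big_cons.
Qed.

(** Divided by [p ^ eval e f], the sum is congruent to [d] modulo [p]. *)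
Lemma sum_neq0 b p e d f r : based b p -> prime p -> e 0 = 1 -> unitc b d ->
  all (fun u => ltf f u.2) r ->
  (d * (p ^ eval e f)%:Z + tsum p e r)%R <> 0%R.
Proof.
move=> bp p_pr e0 d_u lt_r; have p_gt0 := prime_gt0 p_pr.
have [q ->] : exists q, (tsum p e r = (p ^ eval e f)%:Z * p%:Z * q)%R.
  elim: r lt_r => [|[c g] r IH] /=; first by exists 0%R; rewrite big_nil mulr0.
  case/andP => /(eval_ltf e0) lt_fg /IH[q Eq]; rewrite big_cons /= Eq.
  exists (c * (p ^ (eval e g - (eval e f).+1))%:Z + q)%R.
  rewrite -{1}(subnKC lt_fg) expnD expnSr !PoszM; ring.
move=> E0; case/negP: (unitcP bp d_u); apply/dvdzP; exists (- q)%R.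
have pe0 : ((p ^ eval e f)%:Z != 0)%R by rewrite eqz_nat -lt0n expn_gt0 p_gt0.
by apply: (mulfI pe0); apply/eqP; rewrite -subr_eq0 -E0; apply/eqP; ring.
Qed.

(** * The case search and its soundness *)

(** The shapes of a prime-to-[p] FM-exponent; [T] is [form] in the search and [nat] after
    evaluation. [Quo a m] stands for [(p^m+1)/(p^a+1)]. *)
Inductive elem (T : Type) :=
  One | Plus of T | Half of T | Quo of T & T | Seven.
Arguments One {T}.
Arguments Seven {T}.

Definition map_elem (T U : Type) (g : T -> U) (x : elem T) : elem U :=
  match x with
  | One => One
  | Plus m => Plus (g m)
  | Half m => Half (g m)
  | Quo a m => Quo (g a) (g m)
  | Seven => Seven
  end.

(** The data of [x + p^k y = p^l z] that are to be compared with the list; substitutions act on them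
    too, so at a leaf they describe the family found. *)
Definition payload (T : Type) : Type := elem T * elem T * elem T * T.

Definition map_payload (T U : Type) (g : T -> U) (w : payload T) : payload U :=
  let: (x, y, z, k) := w in (map_elem g x, map_elem g y, map_elem g z, g k).

Definition least (T : Type) (lt : rel T) (x : T) (s : seq T) : T :=
  foldl (fun m y => if lt y m then y else m) x s.

(** This order and [dist] are heuristics: soundness holds for any choice of [f] and of a split that
    passes the index checks. *)
Definition lighter : rel form := fun f g =>
  let u := sumn (behead f) in let v := sumn (behead g) in
  (u < v) || (u == v) && (nth 0 f 0 < nth 0 g 0).

Definition subf (f g : form) : form :=
  mkseq (fun k => if k == 0 then 0 else nth 0 f k - nth 0 g k) nvar.

Definition dist (f g : form) : nat := sumn (subf f g) + sumn (subf g f).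

Definition heavy (f : form) : nat :=
  least (fun i j => nth 0 f j < nth 0 f i) 0 (iota 1 nvar.-1).

(** [g] exceeds [f] most in [v_i], and [f] exceeds [g] most in [v_j]. Index 0 for [j] means that [f]
    exceeds [g] in no variable; then [v_i] is compared with 1. *)
Definition splitting (f g : form) : nat * nat :=
  let i := heavy (subf g f) in
  let j := heavy (subf f g) in
  if j == 0 then (0, i) else (i, j).

(* In [search], the case [e i <= e j] gives [shear i j].  In the case [e j < e i],
   either [i = 0] and the variable [j] vanishes, or [v_i := v_j + 1 + v_i]. *)
Section Search.
Variable b : base.
Variable leaf : payload form -> bool.

Fixpoint search (n : nat) (ts : terms) (w : payload form) : bool :=
  if n isn't n'.+1 then false else
  let ns := normalize b ts in
  if ns isn't (_, g) :: ts' then leaf w else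
  let f := least lighter g (map snd ts') in
  let: (d, r) := pull f ns in
  let branch (h : form -> form) :=
    search n' [seq (t.1, h t.2) | t <- ns] (map_payload h w) in
  if [seq u <- map snd r | ~~ ltf f u] isn't v :: vs then unitc b d else
  let: (i, j) := splitting f (least (fun u u' => dist f u < dist f u') v vs) in
  [&& i != j, i < nvar, 0 < j < nvar, branch (shear i j) &
    if i == 0 then branch (clear j) else branch (shear 0 i \o shear j i)].

End Search.

Lemma map_elem_comp (T U V : Type) (g : T -> U) (h : U -> V) x :
  map_elem h (map_elem g x) = map_elem (h \o g) x.
Proof. by case: x. Qed.

Lemma eq_map_elem (T U : Type) (g h : T -> U) : g =1 h -> map_elem g =1 map_elem h.
Proof. by move=> gh [] *; rewrite //= !gh. Qed.

Lemma eq_map_payload (T U V : Type) (g : T -> V) (h : T -> U) (k : U -> V) w :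
  (forall f, k (h f) = g f) -> map_payload k (map_payload h w) = map_payload g w.
Proof.
move=> E; case: w => [[[x y] z] s]; rewrite /= !map_elem_comp E.
by rewrite !(eq_map_elem (h := g)).
Qed.

(** Each substitution changes the forms and the point [e] together, so the evaluated payload and the
    vanishing sum stay the same along a branch. Exhausted fuel yields [false]. *)
Lemma search_sound b p (leaf : payload form -> bool) (good : payload nat -> Prop) :
  based b p -> prime p ->
  (forall w e, e 0 = 1 -> leaf w -> good (map_payload (eval e) w)) ->
  forall n (ts : terms) w e, e 0 = 1 -> search b leaf n ts w ->
    tsum p e ts = 0%R -> good (map_payload (eval e) w).
Proof.
move=> bp p_pr leafP; elim=> // n IH ts w e e0 /=.
rewrite -(normalize_sum ts bp e0).
case: (normalize b ts) => [|[c g] ts']; first by move/(leafP _ _ e0).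
set ns := _ :: _; set f := least _ _ _.
move=> Hs Es; have := pull_sum p e f ns; rewrite Es.
move: Hs; case: (pull f ns) => d r /= Hs.
have step (h : form -> form) e' : e' 0 = 1 ->
    (forall u, eval e' (h u) = eval e u) ->
    search b leaf n [seq (t.1, h t.2) | t <- ns] (map_payload h w) ->
    good (map_payload (eval e) w).
  move=> e'0 Eh Hh; rewrite -(eq_map_payload _ Eh); apply: IH e'0 Hh _.
  rewrite big_map -[RHS]Es; apply: eq_bigr => t _; by rewrite Eh.
case Ef: [seq u <- map snd r | ~~ ltf f u] Hs => [|v vs] /=.
  (* Here [f] lies below all other exponents, so the sum cannot vanish. *)
  move=> /= d_u /esym E0; case: (sum_neq0 bp p_pr e0 d_u _ E0).
  have /hasPn Hr : ~~ has (fun u => ~~ ltf f u) (map snd r) by rewrite has_filter Ef.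
  by apply/allP => u ur; apply/negPn/Hr/map_f.
case: (splitting _ _) => i j /and5P[ij lt_i /andP[j0 lt_j] Hle Hgt] _.
case: (leqP (e i) (e j)) => [le_ij | lt_ji].
  apply: step Hle; last by move=> u; exact: eval_shear.
  by rewrite /upd; case: eqP => // j0'; rewrite -j0' in j0.
case: eqP Hgt => [i0 | /eqP i0] Hgt.
  apply: (step _ e _ _ Hgt) => // u; apply: eval_clear => //.
  by move: lt_ji; rewrite i0 e0; case: (e j).
rewrite eq_sym in ij; have le_ji := ltnW lt_ji.
(* The substitution [v_i := v_j + 1 + v_i] is made of two shears: [e j] is subtracted from [e i],
   then [e 0 = 1]. *)
set e1 := upd e i (e i - e j).
have e10 : e1 0 = 1 by rewrite /e1 /upd eq_sym (negPf i0).
have le1 : e1 0 <= e1 i by rewrite e10 /e1 /upd eqxx subn_gt0.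
apply: (step _ (upd e1 i (e1 i - e1 0)) _ _ Hgt) => [|u].
  by rewrite /upd eq_sym (negPf i0).
by rewrite /= (eval_shear _ _ lt_i _ le1) // ?eval_shear // eq_sym.
Qed.

(** * Values of FM-exponents and the equation cleared of denominators *)

Definition mult (ts us : terms) : terms :=
  [seq ((t.1 * u.1)%R, addf t.2 u.2) | t <- ts, u <- us].

Lemma mult_sum p e ts us : tsum p e (mult ts us) = (tsum p e ts * tsum p e us)%R.
Proof.
rewrite big_allpairs_dep big_distrlr /=; apply: eq_bigr => t _; apply: eq_bigr => u _.
by rewrite eval_addf expnD PoszM mulrACA.
Qed.

Definition numer (p : nat) (x : elem nat) : nat :=
  match x with
  | One => 1
  | Plus m | Half m | Quo _ m => p ^ m + 1
  | Seven => 7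
  end.

Definition denom (p : nat) (x : elem nat) : nat :=
  match x with
  | Half _ => 2
  | Quo a _ => p ^ a + 1
  | _ => 1
  end.

Definition value (p : nat) (x : elem nat) : nat := numer p x %/ denom p x.

(** In [Quo] the factor [b] exceeds 2, since [b = 1] gives the value of [One]. *)
Definition valid (p : nat) (x : elem nat) : Prop :=
  match x with
  | One => True
  | Plus m => p = 2 -> 0 < m
  | Half m => 2 < p /\ 0 < m
  | Quo a m => 0 < a /\ exists b, [/\ odd b, 2 < b & m = a * b]
  | Seven => p = 5
  end.

(** Induction on [(b-1)/2]: with [q = p^a], multiplication by [q^2] preserves residues modulo
    [q+1]. *)
Lemma dvdn_exp_odd p a b : odd b -> p ^ a + 1 %| p ^ (a * b) + 1.
Proof.
move=> ob; rewrite -(odd_double_half b) ob add1n.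
elim: (b./2) => [|c IH]; first by rewrite muln1.
have -> : p ^ (a * (c.+1).*2.+1) = p ^ (a * c.*2.+1) * (p ^ a * p ^ a).
  by rewrite -!expnD; congr (_ ^ _); lia.
set u := p ^ (a * _) in IH *; set q := p ^ a in IH *.
case: (posnP q) => [-> | q_gt0]; first by rewrite dvd1n.
have -> : u * (q * q) + 1 = (u + 1) * (q * q) - (q - 1) * (q + 1).
  by case: q q_gt0 {IH} => // q _; rewrite subn1 /=; nia.
by apply: dvdn_sub; [exact: dvdn_mulr | exact: dvdn_mull].
Qed.

Lemma valueK p x : prime p -> valid p x -> denom p x * value p x = numer p x.
Proof.
move=> p_pr; rewrite /value mulnC.
case: x => [|m|m|a m|] /=; rewrite ?divn1 ?muln1 // => -[].
  move=> p2 m0; rewrite divnK // dvdn2 oddD oddX.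
  by case: (even_prime p_pr) p2 => [->|->]; rewrite ?orbT.
by move=> _ [b [ob _ ->]]; rewrite divnK // dvdn_exp_odd.
Qed.

Definition numer_terms (x : elem form) : terms :=
  match x with
  | One => [:: (1%R, cstf 0)]
  | Plus m | Half m | Quo _ m => [:: (1%R, m); (1%R, cstf 0)]
  | Seven => [:: (Posz 7, cstf 0)]
  end.

Definition denom_terms (x : elem form) : terms :=
  match x with
  | Half _ => [:: (Posz 2, cstf 0)]
  | Quo a _ => [:: (1%R, a); (1%R, cstf 0)]
  | _ => [:: (1%R, cstf 0)]
  end.

Lemma numer_sum p e x : e 0 = 1 ->
  tsum p e (numer_terms x) = Posz (numer p (map_elem (eval e) x)).
Proof.
move=> e0; case: x => [|m|m|a m|] /=; rewrite !big_cons big_nil /= eval_cstf //.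
all: by rewrite ?mul1r ?addr0 ?PoszD.
Qed.

Lemma denom_sum p e x : e 0 = 1 ->
  tsum p e (denom_terms x) = Posz (denom p (map_elem (eval e) x)).
Proof.
move=> e0; case: x => [|m|m|a m|] /=; rewrite !big_cons big_nil /= eval_cstf //.
all: by rewrite ?mul1r ?addr0 ?PoszD.
Qed.

(** This is [x + p^k y - p^l z] multiplied by all three denominators. *)
Definition equation (x y z : elem form) (k l : form) : terms :=
  mult (numer_terms x) (mult (denom_terms y) (denom_terms z)) ++
  mult [:: (1%R, k)] (mult (numer_terms y) (mult (denom_terms x) (denom_terms z))) ++
  mult [:: ((-1)%R, l)] (mult (numer_terms z) (mult (denom_terms x) (denom_terms y))).

Lemma equation_sum p e x y z k l : prime p -> e 0 = 1 ->
  let ev := map_elem (eval e) in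
  valid p (ev x) -> valid p (ev y) -> valid p (ev z) ->
  value p (ev x) + p ^ eval e k * value p (ev y) = p ^ eval e l * value p (ev z) ->
  tsum p e (equation x y z k l) = 0%R.
Proof.
move=> p_pr e0 ev Vx Vy Vz E.
rewrite 2!big_cat !mult_sum !numer_sum // !denom_sum // !big_seq1 -!/(ev _).
rewrite -!(valueK p_pr) // !PoszM.
have {}E := congr1 Posz E; rewrite PoszD !PoszM in E.
transitivity (Posz (denom p (ev x)) * Posz (denom p (ev y)) * Posz (denom p (ev z)) *
  (Posz (value p (ev x)) + Posz (p ^ eval e k) * Posz (value p (ev y))
   - Posz (p ^ eval e l) * Posz (value p (ev z))))%R; first by rewrite /=; ring.
by rewrite E subrr mulr0.
Qed.

Lemma FM_exponent_value p d : prime p -> FM_exponent p d ->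
  exists x, valid p x /\ d = p ^ logn p d * value p x.
Proof.
move=> p_pr [d0 FM].
suff [x [Vx E]] : exists x, valid p x /\ d`_(p^') = value p x.
  by exists x; rewrite -E -p_part partnC.
move: FM; rewrite /ppart_hat => -[] /=.
- by move=> [a [-> a0]]; exists (Plus a); rewrite /value divn1.
- by move=> [p2 [a [a0 ->]]]; exists (Half a).
- move=> [a [b [a0 b0 ob ->]]]; case: (ltnP 2 b) => b3.
    by exists (Quo a (a * b)); split=> //; split=> //; exists b.
  exists One; split=> //; have -> : b = 1 by case: b b0 ob b3 => [|[|[]]].
  by rewrite muln1 divnn addn1.
- by move=> [-> ->]; exists Seven.
Qed.

(** * Parametrisation of the exponents *)

(* In [Quo a m] the quotient [m / a] is odd and at least 3, whence [m = 3a + v]. *)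
Definition templates (b : base) (i : nat) : seq (elem form) :=
  let v := varf i in
  let u := addf (cstf 1) v in
  [:: One; Plus (if b == Some 2 then u else v);
      Quo u (addf (addf u (addf u u)) (varf i.+1))] ++
  (if b == Some 2 then [::] else [:: Half u]) ++
  (if b == Some 5 then [:: Seven] else [::]).

Lemma templates_complete b p i (P : elem form -> bool) x :
  based b p -> i.+1 < nvar -> all P (templates b i) -> valid p x ->
  exists s u v, P s /\ forall e, e 0 = 1 -> e i = u -> e i.+1 = v ->
    map_elem (eval e) s = x.
Proof.
move=> bp lt_i; have lt_i' := ltnW lt_i.
rewrite /templates !all_cat /= andbT => /andP[/and3P[P1 PP PQ] /andP[PH P7]].
case: x => [|m|m|a m|] /= Vx.
- by exists One, 0, 0.
- case: eqP PP => [b2 | b2] PP.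
    have m0 : 0 < m by apply: Vx; rewrite b2 in bp.
    exists (Plus (addf (cstf 1) (varf i))), m.-1, 0; split=> // e e0 eu _.
    by rewrite /= eval_addf eval_cstf // eval_varf // eu add1n prednK.
  by exists (Plus (varf i)), m, 0; split=> // e e0 eu _; rewrite /= eval_varf // eu.
- have {PH}PH : P (Half (addf (cstf 1) (varf i))).
    case: eqP PH => [b2 | _] /=; last by rewrite andbT.
    by case: Vx => p2; rewrite b2 /= in bp; rewrite bp in p2.
  exists (Half (addf (cstf 1) (varf i))), m.-1, 0; split=> // e e0 eu _.
  by rewrite /= eval_addf eval_cstf // eval_varf // eu add1n prednK //; case: Vx.
- case: Vx => a0 [c [oc c3 ->]].
  exists (Quo (addf (cstf 1) (varf i)) (addf (addf (addf (cstf 1) (varf i))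
    (addf (addf (cstf 1) (varf i)) (addf (cstf 1) (varf i)))) (varf i.+1))).
  (* The exponent [a * c] has to be written as [3a + v]. *)
  exists a.-1, (a * (c - 3)); split=> // e e0 eu ev.
  rewrite /= !eval_addf eval_cstf // !eval_varf // eu ev add1n prednK //.
  by congr (Quo _ _); rewrite mulnBr; nia.
- have b5 : b = Some 5 by move: bp; rewrite Vx; case: (b) => [q <- //|].
  by exists Seven, 0, 0; split=> //; rewrite b5 /= andbT in P7.
Qed.

(** * Recognition of the pairs of the list *)

Definition same (x y : elem form) : bool :=
  match x, y with
  | One, One | Seven, Seven => true
  | Plus m, Plus n | Half m, Half n => m == n
  | Quo a m, Quo c n => (a == c) && (m == n)
  | _, _ => false
  end.

(** For [p] at most 7 the bound keeps the powers, computed in unary [nat], at most [2^10]. *)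
Definition small (p : nat) (f : form) : bool :=
  (f == cstf (nth 0 f 0)) && (p * nth 0 f 0 <= 20).

Definition cval (p : nat) (x : elem form) : option nat :=
  if match x with
     | One | Seven => true
     | Plus m | Half m => small p m
     | Quo a m => small p a && small p m
     end
  then Some (value p (map_elem (fun f => nth 0 f 0) x)) else None.

(** [One] is read as [(p^k+1)/(p^k+1)], the case [a = b] of the general families. *)
Definition asquo (k : form) (x : elem form) : option form :=
  match x with
  | One => Some k
  | Quo a m => if a == k then Some m else None
  | _ => None
  end.

(* [partner p c x = Some m] when both [(c, x)] and [(x, c * p^m)] belong to the list. *)
Definition partner (p c : nat) (x : elem form) : option form :=
  match x with
  | Plus m => if (p, c) \in [:: (2, 1); (2, 3); (3, 2)] then Some m else None
  | Half m => if (p, c) \in [:: (3, 1); (3, 4); (5, 2)] then Some m else None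
  | Quo a m =>
      if (a == cstf 1) && ((p, c) \in [:: (2, 1); (2, 5); (3, 2)])
      || (a == cstf 2) && ((p, c) == (2, 3)) then Some m else None
  | _ => None
  end.

(* Next to the sporadic pairs, the members of infinite families of the list that
   occur as isolated leaves in which an exponent is written in another form,
   such as [3 = (2^3 + 1) / (2 + 1)]. *)
Definition small_pairs (p : nat) : seq (nat * nat) :=
  match p with
  | 2 => [:: (1, 12); (1, 10); (3, 8); (3, 40); (11, 6)] ++ sporadic2
  | 3 => [:: (1, 2); (1, 4); (1, 6); (2, 3); (2, 12)] ++ sporadic3
  | 5 => (1, 2) :: sporadic5
  | 7 => [:: (2, 2)]
  | _ => [::]
  end.

(** The families not tied to a particular prime; in that of equal halves, [One] is the half with
    exponent 0. *)
Definition match_general (b : base) (x y : elem form) (k : form) : bool :=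
  (0 < nth 0 k 0) &&
    (if (asquo k x, asquo k y) is (Some m, Some n) then
       (m == n) || (m == addf n (addf k k)) else false)
  || [&& b != Some 2, k == cstf 0, same x y &
      match x with One | Half _ => true | _ => false end].

Definition match_const (p : nat) (x y : elem form) (k : form) : bool :=
  [|| if cval p x is Some c then (k == cstf 0) && (partner p c y != None) else false,
      if cval p y is Some c then partner p c x == Some k else false
    | if (cval p x, cval p y) is (Some c, Some d) then
        small p k && ((c, p ^ nth 0 k 0 * d) \in small_pairs p) else false].

(** The families special to [p = 2] in which both entries vary; those with an entry constant up to a
    power of 2 go through [match_const]. *)
Definition match2 (x y : elem form) (k : form) : bool :=
  (k == cstf 0) && same x y ||
  match x, y with
  | Plus a, Quo c m =>
      (k == cstf 0) &&
      ((c == a) && (m == addf a (addf a a)) || (c == cstf 1) && (m == a))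
  | Quo a m, Plus c => [&& k == a, c == a & m == addf a (addf a a)]
  | Quo a m, Quo c n =>
      [&& a == cstf 3, m == n & (c == cstf 1) && (k == cstf 0) ||
                                (c == cstf 3) && (k == cstf 1)]
  | _, _ => false
  end.

Definition match3 (x y : elem form) (k : form) : bool :=
  (k == cstf 0) &&
  match x, y with
  | Plus m, Half n => m == n
  | Half m, Quo c n => (c == cstf 1) && (m == n)
  | Quo a m, Quo c n => [&& a == cstf 1, c == cstf 1 & m == n]
  | _, _ => false
  end.

Definition matches (b : base) (x y : elem form) (k : form) : bool :=
  [|| match_general b x y k,
      if b is Some p then match_const p x y k else false,
      (b == Some 2) && match2 x y k
    | (b == Some 3) && match3 x y k].

Definition quotients (xs : seq (elem form)) : seq (form * form) :=
  pmap (fun x => if x is Quo a m then Some (a, m) else None) xs.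

(** If the constant term of [n] is below that of [m], truncation makes [c] zero and the test
    fails. *)
Definition incongruent (d : nat) (m n : form) : bool :=
  let c := nth 0 n 0 - nth 0 m 0 in (n == addf m (cstf c)) && ~~ (d %| c).

(* [Quo a m] is only valid when [a] divides [m]. *)
Definition impossible (xs : seq (elem form)) : bool :=
  let qs := quotients xs in
  has (fun q => let d := nth 0 q.1 0 in (q.1 == cstf d) &&
    has (fun r => (r.1 == q.1) && incongruent d r.2 q.2) ((q.1, cstf 0) :: qs)) qs.

(** For [k = 0] the roles of [x] and [y] are symmetric, so both orders are tried. *)
Definition leaf (b : base) (w : payload form) : bool :=
  let: (x, y, z, k) := w in
  [|| impossible [:: x; y; z], matches b x y k | (k == cstf 0) && matches b y x k].

(** * The computation *)

Definition for_templates (b : base) (P : elem form -> elem form -> elem form -> bool) :=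
  all (fun x => all (fun y => all (P x y) (templates b 5)) (templates b 3))
    (templates b 1).

(** Variable 7 carries [l] when [k = 0], and [k - 1] when [k > 0] and [l = 0]. *)
Definition solves (b : base) (solver : terms -> payload form -> bool) : bool :=
  for_templates b (fun x y z =>
    solver (equation x y z (cstf 0) (varf 7)) (x, y, z, cstf 0) &&
    let k := addf (cstf 1) (varf 7) in solver (equation x y z k (cstf 0)) (x, y, z, k)).

Lemma search_solves b : b \in [:: Some 2; Some 3; Some 5; Some 7; None] ->
  solves b (search b (leaf b) 40).
Proof. by rewrite !inE => /or4P[/eqP->|/eqP->|/eqP->|/orP[]/eqP->]; vm_compute. Qed.

(** * Soundness of the recognition *)

Section Soundness.

Variables (p : nat) (e : nat -> nat).
Hypothesis e0 : e 0 = 1.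

Local Notation ev := (map_elem (eval e)).
Local Notation val x := (value p (ev x)).

Lemma value_Plus q m : value q (Plus m) = q ^ m + 1.
Proof. exact: divn1. Qed.

Lemma same_eq x y : same x y -> x = y.
Proof.
by case: x => [|m|m|a m|]; case: y => [|n|n|c n|] //=; 
  first [move/eqP-> | case/andP=> /eqP-> /eqP->].
Qed.

Lemma eval_small f : small p f -> eval e f = nth 0 f 0.
Proof. by case/andP=> /eqP -> _; rewrite eval_cstf // nth_mkseq. Qed.

Lemma cval_value x c : cval p x = Some c -> val x = c.
Proof.
rewrite /cval; case: x => [|m|m|a m|] /=; first by case.
- by case: ifP => // /eval_small-> [].
- by case: ifP => // /eval_small-> [].
- by case: ifP => // /andP[/eval_small-> /eval_small->] [].
- by case.
Qed.

Lemma asquo_value x k m : asquo k x = Some m -> valid p (ev x) -> 0 < eval e k ->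
  odd_mult (eval e m) (eval e k) /\
  val x = (p ^ eval e m + 1) %/ (p ^ eval e k + 1).
Proof.
case: x => [|//|//|a n|//] /=.
  by move=> [->] _ k0; rewrite /odd_mult leqnn dvdnn !divnn k0 addn1.
case: eqP => // -> [<-] [_ [b [ob b3 ->]]] k0; split=> //.
by rewrite /odd_mult dvdn_mulr // mulKn // leq_pmulr //; case: b ob b3.
Qed.

Lemma partner_pair c x m : partner p c x = Some m -> valid p (ev x) ->
  FM_pair p c (val x) /\ FM_pair p (val x) (p ^ eval e m * c).
Proof.
case: x => [//|n|n|a n|//] /=; case: ifP => // + [<-{m}].
- rewrite value_Plus !inE => /or3P[] /eqP[-> ->] n0.
  + by split; do 3 right; left; split=> //; [do 3 right|do 4 right]; left;
      exists (eval e n); rewrite ?muln1 n0.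
  + by split; do 3 right; left; split=> //; [do 5 right|do 6 right]; left;
      exists (eval e n); rewrite 1?mulnC n0.
  + by split; do 4 right; left; split=> //; [do 1 right|do 2 right]; left;
      exists (eval e n); rewrite 1?mulnC.
- rewrite !inE => /or3P[] /eqP[-> ->] n0.
  + by split; do 4 right; left; split=> //; [do 4 right|do 5 right]; left;
      exists (eval e n); rewrite ?muln1.
  + by split; do 4 right; left; split=> //; [do 6 right|do 7 right]; left;
      exists (eval e n); rewrite 1?mulnC.
  + by split; do 5 right; left; split=> //; [do 1 right; left|do 2 right];
      exists (eval e n); rewrite 1?mulnC.
case/orP=> /andP[/eqP-> ]; rewrite eval_cstf //.
- rewrite !inE => /or3P[] /eqP[-> ->] [_ [b [ob b3 ->]]]; rewrite mul1n;
    have b0 : 0 < b by case: b ob {b3}.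
  + by split; do 3 right; left; split=> //; [do 10 right|do 11 right]; left;
      exists b; rewrite ?muln1.
  + by split; do 3 right; left; split=> //; [do 14 right|do 15 right]; left;
      exists b; rewrite 1?mulnC.
  + by split; do 4 right; left; split=> //; [do 10 right; left|do 11 right];
      exists b; rewrite 1?mulnC.
- move/eqP=> [-> ->] [_ [b [ob b3 ->]]]; have b0 : 0 < b by case: b ob {b3}.
  by split; do 3 right; left; split=> //; [do 12 right|do 13 right]; left;
      exists b; rewrite 1?[_ * 3]mulnC.
Qed.

Lemma small_pairs_sym c d : (c, d) \in small_pairs p -> FM_pair p c d \/ FM_pair p d c.
Proof.
rewrite /small_pairs; case: p => [|[|[|[|[|[|[|[|//]]]]]]]] //.
- rewrite mem_cat => /orP[]; last by left; do 3 right; left; split=> //; left.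
  rewrite !inE => /or4P[|||/orP[]] /eqP[-> ->]; left.
  + by do 3 right; left; split=> //; do 13 right; left; exists 1.
  + by do 3 right; left; split=> //; do 15 right; left; exists 1.
  + by do 3 right; left; split=> //; do 11 right; left; exists 3.
  + by do 3 right; left; split=> //; do 15 right; left; exists 3.
  (* [11 = (2^5+1)/3] and [6 = 2 * (2^3+1)/3]. *)
  + by right; left; exists 3, 1.
- rewrite mem_cat => /orP[]; last by left; do 4 right; left; split=> //; left.
  rewrite !inE => /or4P[|||/orP[]] /eqP[-> ->].
  + by left; do 4 right; left; split=> //; do 4 right; left; exists 1.
  + by right; do 4 right; left; split=> //; do 6 right; left; exists 0.
  + by left; do 4 right; left; split=> //; do 11 right; exists 1.
  + by left; do 4 right; left; split=> //; do 5 right; left; exists 1.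
  + by left; do 4 right; left; split=> //; do 7 right; left; exists 1.
- rewrite inE => /orP[/eqP[-> ->]|]; last by left; do 5 right; left; split=> //; left.
  by right; do 5 right; left; split=> //; right; left; exists 0.
by rewrite inE => /eqP[-> ->]; left; do 6 right.
Qed.

Lemma match_general_pair b x y k : based b p -> prime p ->
  valid p (ev x) -> valid p (ev y) -> match_general b x y k ->
  FM_pair p (val x) (p ^ eval e k * val y).
Proof.
move=> bp p_pr Vx Vy; case/orP.
  case/andP=> k0; have {}k0 : 0 < eval e k.
    by rewrite (@evalD1 _ _ 0) // e0 muln1 ltn_addr.
  case Ex: (asquo k x) => [m|//]; case Ey: (asquo k y) => [n|//].
  have [om ->] := asquo_value Ex Vx k0; have [on ->] := asquo_value Ey Vy k0.
  case/orP=> /eqP mE; first by left; exists (eval e m), (eval e k); rewrite mE.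
  right; left; exists (eval e n), (eval e k).
  by rewrite mE !eval_addf addnn mul2n.
case/and4P=> b2 /eqP-> /same_eq<- Hx; rewrite eval_cstf // mul1n.
right; right; left; split.
  rewrite ltn_neqAle prime_gt1 // andbT eq_sym.
  case: b bp b2 => [q ->|/= p11 _]; first by apply: contraNneq => ->.
  by apply: contraTneq p11 => ->.
case: x Hx {Vx Vy} => [|//|m|//|//] _; first by exists 0.
by exists (eval e m).
Qed.

Lemma match2_pair x y k : p = 2 -> valid p (ev x) -> valid p (ev y) ->
  match2 x y k -> FM_pair p (val x) (p ^ eval e k * val y).
Proof.
move=> p2 Vx Vy Hm; rewrite p2 in Vx Vy *; do 3 right; left; split=> //.
case/orP: Hm => [/andP[/eqP-> /same_eq xy]|].
  rewrite -xy eval_cstf // mul1n {y xy Vy}.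
  case: x Vx => [|m|m|a m|] //=.
  (* The pair of ones is written with [1 = (2^1+1)/(2^1+1)]. *)
  - by move=> _; do 2 right; left; exists 1, 1; split.
  - by move/(_ erefl)=> m0; right; left; exists (eval e m); rewrite value_Plus.
  - by case.
  - move=> [a0 [b [ob b3 ->]]]; do 2 right; left.
    exists (eval e a * b), (eval e a); split=> //.
    by rewrite /odd_mult dvdn_mulr // mulKn // leq_pmulr //; case: b ob b3.
case: x Vx => [//|a|//|a m|//]; case: y Vy => [//|c|//|c n|//] //=.
- move=> Vc /(_ erefl) a0 /andP[/eqP->]; rewrite eval_cstf // mul1n value_Plus.
  case/orP=> /andP[/eqP cE /eqP nE].
    do 7 right; left; exists (eval e a); split=> //.
    by rewrite /value /= cE nE !eval_addf !mulSn mul0n addn0.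
  case: Vc => _ [b [ob b3]]; rewrite cE nE eval_cstf // mul1n => ->.
  by do 9 right; left; exists b; split=> //; case: b ob b3.
- move=> c0 _ /and3P[/eqP kE /eqP cE /eqP mE].
  do 8 right; left; exists (eval e a).
  by rewrite -cE kE -cE mE !eval_addf /value /= divn1 cE !mulSn mul0n addn0;
    split=> //; rewrite -cE; exact: c0.
- move=> _ [_ [b [ob b3 mE]]] /and3P[/eqP aE /eqP <-] Hc.
  rewrite aE eval_cstf // in mE *.
  have b0 : 0 < b by case: b ob {b3 mE}.
  case/orP: Hc => /andP[/eqP-> /eqP->]; rewrite !eval_cstf // mE ?mul1n.
    by do 16 right; left; exists b.
  by do 17 right; exists b.
Qed.

Lemma match3_pair x y k : p = 3 -> valid p (ev x) -> valid p (ev y) ->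
  match3 x y k -> FM_pair p (val x) (p ^ eval e k * val y).
Proof.
move=> p3 Vx Vy Hm; rewrite p3 in Vx Vy *; do 4 right; left; split=> //.
case/andP: Hm => /eqP-> Hm; rewrite eval_cstf // mul1n.
case: x Vx Hm => [//|m|m|a m|//]; case: y Vy => [//|//|n|c n|//] //=.
- by move=> _ _ /eqP->; do 3 right; left; exists (eval e n); rewrite /value /= divn1.
- move=> [_ [b [ob b3 nE]]] _ /andP[/eqP cE /eqP mn].
  rewrite cE eval_cstf // mul1n in nE; rewrite mn cE nE eval_cstf //.
  by do 8 right; left; exists b; split=> //; case: b ob b3 {nE}.
- move=> [_ [b [ob b3 nE]]] _ /and3P[/eqP-> /eqP cE /eqP->].
  rewrite cE eval_cstf // mul1n in nE; rewrite cE nE eval_cstf //.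
  by do 9 right; left; exists b; split=> //; case: b ob b3 {nE}.
Qed.

Lemma match_const_pair x y k : valid p (ev x) -> valid p (ev y) ->
  match_const p x y k ->
  FM_pair p (val x) (p ^ eval e k * val y) \/ FM_pair p (p ^ eval e k * val y) (val x).
Proof.
move=> Vx Vy /or3P[].
- case Ex: (cval p x) => [c|//] /andP[/eqP-> ].
  case Ey: (partner p c y) => [m|//] _; left.
  by rewrite (cval_value Ex) eval_cstf // mul1n; case: (partner_pair Ey Vy).
- case Ey: (cval p y) => [c|//] /eqP Ex; left.
  by rewrite (cval_value Ey); case: (partner_pair Ex Vx).
case Ex: (cval p x) => [c|//]; case Ey: (cval p y) => [d|//].
case/andP=> /eval_small-> /small_pairs_sym.
by rewrite (cval_value Ex) (cval_value Ey).
Qed.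

End Soundness.

(** Exponents over the same constant [a = d] are multiples of [d], hence so are their differences;
    the added exponent 0 tests a single one. *)
Lemma impossible_false p e xs : e 0 = 1 ->
  impossible xs -> foldr (fun x => and (valid p (map_elem (eval e) x))) True xs -> False.
Proof.
move=> e0; pose good q := eval e q.1 %| eval e q.2.
have good_quo : foldr (fun x => and (valid p (map_elem (eval e) x))) True xs ->
    all good (quotients xs).
  elim: xs => //= x xs IH [Vx /IH Hxs].
  case: x Vx => [||||] //= a m [_ [b [_ _ mE]]].
  by rewrite Hxs andbT /good /= mE dvdn_mulr.
move=> Hi /good_quo /allP Hg.
move: Hi => /hasP[q q_in /andP[/eqP q1 /hasP[r r_in /andP[/eqP r1]]]].
rewrite /incongruent => /andP[/eqP q2 /negP]; case.
have gq : nth 0 q.1 0 %| eval e q.2.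
  by have := Hg _ q_in; rewrite /good q1 eval_cstf // nth_mkseq.
have gr : nth 0 q.1 0 %| eval e r.2.
  move: r_in; rewrite inE => /orP[/eqP-> /=|/Hg]; first by rewrite eval_cstf.
  by rewrite /good r1 q1 eval_cstf // nth_mkseq.
by rewrite q2 eval_addf eval_cstf // dvdn_addr in gq.
Qed.

Lemma matches_pair b p e x y k : e 0 = 1 -> based b p -> prime p ->
  valid p (map_elem (eval e) x) -> valid p (map_elem (eval e) y) -> matches b x y k ->
  let u := value p (map_elem (eval e) x) in
  let v := p ^ eval e k * value p (map_elem (eval e) y) in
  FM_pair p u v \/ FM_pair p v u.
Proof.
move=> e0 bp p_pr Vx Vy /or4P[Hm | Hm | /andP[/eqP b2 Hm] | /andP[/eqP b3 Hm]] u v.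
- by left; apply: match_general_pair Hm.
- by case: b bp Hm => // q /= <- Hm; apply: match_const_pair.
- by left; apply: match2_pair => //; rewrite b2 in bp.
- by left; apply: match3_pair => //; rewrite b3 in bp.
Qed.

(** * From the search to the theorem *)

(** Validity is a premise inside, so that an impossible leaf is good vacuously. *)
Definition good (p : nat) (w : payload nat) : Prop :=
  let: (x, y, z, k) := w in
  valid p x -> valid p y -> valid p z ->
  FM_pair p (value p x) (p ^ k * value p y) \/
  FM_pair p (p ^ k * value p y) (value p x).

Lemma leaf_good b p w e : based b p -> prime p -> e 0 = 1 -> leaf b w ->
  good p (map_payload (eval e) w).
Proof.
case: w => [[[x y] z] k] bp p_pr e0 /= /or3P[Hi | Hm | /andP[/eqP-> Hm]] Vx Vy Vz.
- by case: (@impossible_false p _ _ e0 Hi).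
- exact: matches_pair Hm.
- have := matches_pair e0 bp p_pr Vy Vx Hm; rewrite eval_cstf //= !mul1n.
  by case; [right | left].
Qed.

(** The template is fixed before [h], because what variable 7 stands for depends on whether [k] is
    0. *)
Lemma for_templates_complete b p P x y z : based b p -> for_templates b P ->
  valid p x -> valid p y -> valid p z ->
  exists s t r, P s t r /\ forall h, exists e, [/\ e 0 = 1, e 7 = h &
    [/\ map_elem (eval e) s = x, map_elem (eval e) t = y & map_elem (eval e) r = z]].
Proof.
move=> bp S Vx Vy Vz.
have [s [u1 [u2 [{}S Es]]]] := templates_complete bp (isT : 2 < nvar) S Vx.
have [t [v1 [v2 [{}S Et]]]] := templates_complete bp (isT : 4 < nvar) S Vy.
have [r [w1 [w2 [{}S Er]]]] := templates_complete bp (isT : 6 < nvar) S Vz.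
exists s, t, r; split=> // h; exists (nth 0 [:: 1; u1; u2; v1; v2; w1; w2; h]).
by split=> //; split; [apply: Es | apply: Et | apply: Er].
Qed.

(* [solver] is kept abstract so that the kernel never unfolds [search] on open terms. *)
Lemma solves_good b p (solver : terms -> payload form -> bool) x y z (k l : nat) :
  based b p -> prime p -> (k == 0) || (l == 0) ->
  (forall (ts : terms) w e, e 0 = 1 -> solver ts w -> tsum p e ts = 0%R ->
    good p (map_payload (eval e) w)) ->
  solves b solver ->
  value p x + p ^ k * value p y = p ^ l * value p z -> good p (x, y, z, k).
Proof.
move=> bp p_pr kl solverP S E Vx Vy Vz.
have [s [t [r [/andP[Sl Sk] H]]]] := for_templates_complete bp S Vx Vy Vz.
have conclude e f g : e 0 = 1 -> eval e f = k -> eval e g = l ->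
    map_elem (eval e) s = x -> map_elem (eval e) t = y -> map_elem (eval e) r = z ->
    solver (equation s t r f g) (s, t, r, f) -> good p (x, y, z, k).
  move=> e0 fk gl Ex Ey Ez Hs; rewrite -Ex -Ey -Ez -fk.
  apply: (solverP _ (s, t, r, f) e e0 Hs).
  by apply: equation_sum; rewrite // ?Ex ?Ey ?Ez // fk gl.
have [k0 | k0] := posnP k.
  have [e [e0 e7 [Ex Ey Ez]]] := H l.
  by apply: (conclude e _ _ _ _ _ Ex Ey Ez Sl); rewrite ?eval_cstf ?eval_varf.
have [e [e0 e7 [Ex Ey Ez]]] := H k.-1.
apply: (conclude e _ _ _ _ _ Ex Ey Ez Sk) => //.
  by rewrite eval_addf eval_cstf // eval_varf // e7 add1n prednK.
by case: eqP kl k0 => [-> //|_ /eqP->]; rewrite eval_cstf.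
Qed.

Theorem mainTheorem12 (p A B : nat) :
  prime p -> 0 < A -> 0 < B -> coprime A p ->
  FM_exponent p A -> FM_exponent p B -> FM_exponent p (A + B) ->
  FM_pair p A B \/ FM_pair p B A.
Proof.
move=> p_pr A0 B0 coAp.
move=> /(FM_exponent_value p_pr)[x [Vx EA]] /(FM_exponent_value p_pr)[y [Vy EB]].
case/(FM_exponent_value p_pr)=> z [Vz EC].
have pA : ~~ (p %| A) by rewrite -prime_coprime // coprime_sym.
have {}EA : A = value p x by rewrite EA lognE p_pr A0 (negPf pA) mul1n.
have kl : (logn p B == 0) || (logn p (A + B) == 0).
  case: (posnP (logn p B)) => //= kB; have pB : p %| B.
    by move: kB; rewrite lognE; case: (p %| B) => //; rewrite !andbF.
  by rewrite lognE dvdn_addl // (negPf pA) !andbF.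
have [b bp b_in] : exists2 b, based b p & b \in [:: Some 2; Some 3; Some 5; Some 7; None].
  case: (leqP 11 p) => p11; first by exists None.
  exists (Some p) => //; move: p_pr p11; clear.
  by do 11 (case: p => [//|p]).
have E : value p x + p ^ logn p B * value p y = p ^ logn p (A + B) * value p z.
  by rewrite -EB -EC -EA.
have leafP w e := @leaf_good b p w e bp p_pr.
have searchP := search_sound (good := good p) bp p_pr leafP (n := 40).
have := solves_good bp p_pr kl searchP (search_solves b_in) E Vx Vy Vz.
by rewrite -EB -EA.
Qed.
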